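(* Let $E$ be a Banach space. If the free Banach lattice $FBL[E]$ is $\infty$-projective, then $E$ has the Schur property, i.e. every weakly convergent sequence in $E$ converges in norm.
   Context: All Banach spaces and Banach lattices are real. A Banach lattice homomorphism is a bounded linear map preserving the lattice operations $\vee,\wedge$. For a real number $\lambda>1$, a Banach lattice $P$ is $\lambda$-projective if whenever $X$ is a Banach lattice, $J$ a closed (order) ideal in $X$ and $Q\colon X\to X/J$ the quotient map, then for every Banach lattice homomorphism $T\colon P\to X/J$ there is a Banach lattice homomorphism $\hat T\colon P\to X$ such that $T=Q\circ\hat T$ and $\|\hat T\|\le\lambda\|T\|$. $P$ is $\infty$-projective if it is $\lambda$-projective for some $\lambda>1$. For a Banach space $E$, the free Banach lattice generated by $E$, denoted $FBL[E]$, is a Banach lattice together with a bounded operator $u\colon E\to FBL[E]$ such that for every Banach lattice $Y$ and every bounded operator $T\colon E\to Y$ there is a unique Banach lattice homomorphism $S\colon FBL[E]\to Y$ with $S\circ u=T$ and $\|S\|=\|T\|$. It exists and is unique up to Banach lattice isometry. Concretely, for $f\colon E^*\to\mathbb{R}$ put $$\|f\|_{FBL[E]}=\sup\Big\{\sum_{i=1}^n|f(x_i^* )| : n\in\mathbb{N},\ x_1^*,\dots,x_n^*\in E^*,\ \sup_{x\in B_E}\sum_{i=1}^n|x_i^*(x)|\le 1\Big\},$$ where $B_E$ is the closed unit ball; $FBL[E]$ is the closure, with respect to this norm, of the vector lattice (with pointwise operations) generated by the evaluations $\delta_x\colon x^*\mapsto x^*(x)$, $x\in E$, among the positively homogeneous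 functions $E^*\to\mathbb{R}$ of finite norm, and $u(x)=\delta_x$. *)

(* Defs.v *)
From HB Require Import structures.
From mathcomp Require Import all_boot all_order all_algebra generic_quotient.
From mathcomp Require Import ring_quotient.
From mathcomp Require Import all_classical all_reals.
From mathcomp Require Import topology normedtype sequences.

Set Implicit Arguments.
Unset Strict Implicit.
Unset Printing Implicit Defensive.

Import Order.TTheory GRing.Theory Num.Theory.
Import numFieldNormedType.Exports.

Local Open Scope classical_set_scope.
Local Open Scope ring_scope.
Local Open Scope quotient_scope.

(* Real vector lattices. MathComp's [Order.Lattice] mixins cannot be joined
   here with [GRing.Lmodule]: Hierarchy Builder would require such a structure
   to sit below [Num.RealDomain]. The order is therefore carried by this mixin;
   [vle_meet] and [vjoin_le] say that [vmeet x y] and [vjoin x y] are the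
   infimum and the supremum of [x] and [y]. *)
HB.mixin Record Lmodule_isVectorLattice (R : numDomainType) V
    of GRing.Lmodule R V := {
  vle : rel V;
  vmeet : V -> V -> V;
  vjoin : V -> V -> V;
  vle_refl : reflexive vle;
  vle_anti : antisymmetric vle;
  vle_transitive : transitive vle;
  vle_meet : forall x y z, vle x (vmeet y z) = vle x y && vle x z;
  vjoin_le : forall x y z, vle (vjoin x y) z = vle x z && vle y z;
  vleD2r : forall z x y : V, vle x y -> vle (x + z) (y + z);
  vleZ : forall (a : R) (x y : V), 0 <= a -> vle x y -> vle (a *: x) (a *: y)
}.

#[short(type="vectorLatticeType")]
HB.structure Definition VectorLattice (R : numDomainType) :=
  {V of GRing.Lmodule R V & Lmodule_isVectorLattice R V}.

Arguments vleD2r {R s} z [x y].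
Arguments vleZ {R s} [a x y].

Definition modulus (R : numDomainType) (V : vectorLatticeType R) (x : V) : V :=
  vjoin x (- x).

HB.mixin Record VectorLattice_isBanachLattice (R : realType) X
    of CompleteNormedModule R X & VectorLattice R X := {
  vnorm_mono : forall x y : X, vle (modulus x) (modulus y) -> `|x| <= `|y|
}.

#[short(type="banachLatticeType")]
HB.structure Definition BanachLattice (R : realType) :=
  {X of CompleteNormedModule R X & VectorLattice R X
   & VectorLattice_isBanachLattice R X}.

(* Closed order ideals: norm-closed, solid linear subspaces. *)
Record closedIdeal (R : realType) (X : banachLatticeType R) := ClosedIdeal {
  ideal_pred :> {pred X};
  ideal_submod : submod_closed ideal_pred;
  ideal_solid : forall x y : X,
    vle (modulus x) (modulus y) -> y \in ideal_pred -> x \in ideal_pred;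
  ideal_closed : closed [set` ideal_pred]
}.

HB.instance Definition _ (R : realType) (X : banachLatticeType R)
    (J : closedIdeal X) :=
  GRing.isSubmodClosed.Build R X (ideal_pred J)
    (GRing.submod_closed_semi (ideal_submod J)).

Section VectorLatticeTheory.
Variables (R : numFieldType) (V : vectorLatticeType R).
Implicit Types x y z : V.

Lemma vle_trans y x z : vle x y -> vle y z -> vle x z.
Proof. exact: vle_transitive. Qed.

Lemma vleD x y z w : vle x y -> vle z w -> vle (x + z) (y + w).
Proof.
move=> xy zw; apply: vle_trans (vleD2r z xy) _.
by rewrite ![y + _]addrC; exact: vleD2r.
Qed.

Lemma vleB2r z x y : vle (x + z) (y + z) = vle x y.
Proof. by apply/idP/idP => [/(vleD2r (- z))|/(vleD2r z)//]; rewrite !addrK. Qed.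

Lemma vsubr_ge0 x y : vle 0 (y - x) = vle x y.
Proof. by rewrite -(vleB2r x) add0r subrK. Qed.

Lemma vleN2 x y : vle (- x) (- y) = vle y x.
Proof. by rewrite -vsubr_ge0 opprK addrC vsubr_ge0. Qed.

Lemma vle_joinl x y : vle x (vjoin x y).
Proof. by have := vle_refl (vjoin x y); rewrite vjoin_le => /andP[]. Qed.

Lemma vle_joinr x y : vle y (vjoin x y).
Proof. by have := vle_refl (vjoin x y); rewrite vjoin_le => /andP[]. Qed.

Lemma vmeet_lel x y : vle (vmeet x y) x.
Proof. by have := vle_refl (vmeet x y); rewrite vle_meet => /andP[]. Qed.

Lemma vmeet_ler x y : vle (vmeet x y) y.
Proof. by have := vle_refl (vmeet x y); rewrite vle_meet => /andP[]. Qed.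

Lemma vle_eq x y : vle x y -> vle y x -> x = y.
Proof. by move=> xy yx; apply: vle_anti; rewrite xy. Qed.

Lemma vle_eqjoin x y : vle x y = (vjoin x y == y).
Proof.
apply/idP/eqP => [xy|<-]; last exact: vle_joinl.
by apply: vle_eq; rewrite ?vle_joinr // vjoin_le xy vle_refl.
Qed.

Lemma vjoinxx x : vjoin x x = x.
Proof. by apply/eqP; rewrite -vle_eqjoin vle_refl. Qed.

Lemma vjoinC x y : vjoin x y = vjoin y x.
Proof. by apply: vle_eq; rewrite vjoin_le vle_joinl vle_joinr. Qed.

Lemma vjoinA x y z : vjoin x (vjoin y z) = vjoin (vjoin x y) z.
Proof.
apply: vle_eq; rewrite !vjoin_le.
  rewrite vle_joinr andbT.
  by apply/andP; split; apply: vle_trans (vle_joinl _ z);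
    [exact: vle_joinl|exact: vle_joinr].
rewrite vle_joinl /=.
by apply/andP; split; apply: vle_trans (vle_joinr x _);
  [exact: vle_joinl|exact: vle_joinr].
Qed.

Lemma vjoinD2r z x y : vjoin x y + z = vjoin (x + z) (y + z).
Proof.
apply: vle_eq; last by rewrite vjoin_le !vleB2r vle_joinl vle_joinr.
rewrite -(vleB2r (- z)) addrK vjoin_le -(vleB2r z) subrK vle_joinl /=.
by rewrite -(vleB2r z) subrK vle_joinr.
Qed.

Lemma vle_addr x y : vle x (x + y) = vle 0 y.
Proof. by rewrite -{1}[x]add0r [x + y]addrC vleB2r. Qed.

Lemma vmeetE x y : vmeet x y = x + y - vjoin x y.
Proof.
apply: vle_eq.
  rewrite -vleN2 -(vleB2r (x + y)) opprB subrK vjoin_le [- _ + _]addrC.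
  rewrite -[X in vle x X]addrA vle_addr vsubr_ge0 vmeet_ler /=.
  by rewrite [x + y]addrC -addrA vle_addr vsubr_ge0 vmeet_lel.
rewrite vle_meet -(vleB2r (vjoin x y - x)) addrA subrK addrAC subrr add0r.
rewrite [x + _]addrC subrK vle_joinr /=.
rewrite -(vleB2r (vjoin x y - y)) addrA subrK addrK [y + _]addrC subrK.
exact: vle_joinl.
Qed.

Lemma vle_modulus x : vle x (modulus x). Proof. exact: vle_joinl. Qed.

Lemma vleN_modulus x : vle (- modulus x) x.
Proof. by rewrite -[X in vle _ X]opprK vleN2 vle_joinr. Qed.

Lemma vmodulus_le x y : vle (modulus x) y = vle x y && vle (- y) x.
Proof. by rewrite vjoin_le -[vle (- y) x]vleN2 opprK. Qed.

Lemma modulus_ge0 x : vle 0 (modulus x).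
Proof.
have := vle_trans (vleN_modulus x) (vle_modulus x).
rewrite -vsubr_ge0 opprK => h.
have /vleZ/(_ h) : 0 <= 2^-1 :> R by rewrite invr_ge0 ler0n.
rewrite scaler0 -mulr2n -[modulus x *+ 2]scaler_nat scalerA.
by rewrite mulVf ?pnatr_eq0 // scale1r.
Qed.

Lemma modulus_joinBl x x' y :
  vle (modulus (vjoin x y - vjoin x' y)) (modulus (x - x')).
Proof.
have H a b : vle (vjoin a y - vjoin b y) (modulus (a - b)).
  rewrite -(vleB2r (vjoin b y)) subrK addrC vjoinD2r vjoin_le.
  rewrite (vle_trans _ (vle_joinl _ _)) /=; last first.
    by rewrite -(vleB2r (- b)) addrAC subrr add0r vle_modulus.
  apply: vle_trans (vle_joinr _ _).
  by rewrite -{1}[y]addr0 vleD ?vle_refl ?modulus_ge0.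
rewrite vmodulus_le H /= -vleN2 opprK opprB (vle_trans (H _ _)) //.
by rewrite -opprB {1}/modulus opprK vjoinC vle_refl.
Qed.

Lemma vjoinZ a x y : 0 <= a -> vjoin (a *: x) (a *: y) = a *: vjoin x y.
Proof.
rewrite le_eqVlt => /predU1P[<-|a0]; first by rewrite !scale0r vjoinxx.
have [an0 av] : a != 0 /\ 0 <= a^-1 by rewrite invr_ge0 ltW // lt0r_neq0.
apply: vle_eq; first by rewrite vjoin_le !vleZ ?vle_joinl ?vle_joinr ?ltW.
rewrite -[X in vle _ X](scalerKV an0) vleZ ?ltW // vjoin_le.
rewrite -{1}[x](scalerK an0) -{2}[y](scalerK an0).
by rewrite !vleZ ?vle_joinl ?vle_joinr.
Qed.

End VectorLatticeTheory.

Section Quotient.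
Variables (R : realType) (X : banachLatticeType R) (J : closedIdeal X).

(* The quotient Banach lattice X/J: the linear structure, the order and the
   lattice operations are induced from X through representatives, and the norm
   is the quotient norm (see [quotient_map_linear], [quotient_map_join],
   [quotient_map_meet] and [qnormE]). *)
Definition ideal_quotient : Type := Quotient.quot J.

HB.instance Definition _ := GRing.Zmodule.on ideal_quotient.

Definition quotient_map (x : X) : ideal_quotient := \pi_(Quotient.quot J) x.

Local Notation pi := quotient_map.
Local Notation Q := ideal_quotient.

Lemma quotient_mapP (q : Q) : exists x, pi x = q.
Proof. by exists (repr (q : Quotient.quot J)); rewrite /quotient_map reprK. Qed.

Lemma quotient_map_eq x y : pi x = pi y <-> x - y \in J.
Proof. by rewrite Quotient.idealrBE; split => /eqP. Qed.

Lemma quotient_mapD : {morph pi : x y / x + y}.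
Proof. by move=> x y; rewrite /quotient_map raddfD. Qed.

Lemma quotient_mapN : {morph pi : x / - x}.
Proof. by move=> x; rewrite /quotient_map raddfN. Qed.

Lemma quotient_map0 : pi 0 = 0.
Proof. by rewrite /quotient_map raddf0. Qed.

Definition qrepr (q : Q) : X := repr (q : Quotient.quot J).

Lemma qreprK : cancel qrepr pi.
Proof. by move=> q; rewrite /quotient_map /qrepr reprK. Qed.

Definition qscale (a : R) (q : Q) : Q := pi (a *: qrepr q).
Definition qjoin (p q : Q) : Q := pi (vjoin (qrepr p) (qrepr q)).
Definition qmeet (p q : Q) : Q := pi (vmeet (qrepr p) (qrepr q)).
Definition qle (p q : Q) : bool := qjoin p q == q.
Definition qnorm (q : Q) : R := inf [set `|x| | x in [set x | pi x = q]].

Lemma qreprB x : qrepr (pi x) - x \in J.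
Proof. by apply/quotient_map_eq; rewrite qreprK. Qed.

Lemma pi_scale a x : pi (a *: x) = qscale a (pi x).
Proof.
by apply/esym/quotient_map_eq; rewrite -scalerBr rpredZ // qreprB.
Qed.

Lemma pi_join x y : pi (vjoin x y) = qjoin (pi x) (pi y).
Proof.
rewrite /qjoin; apply/quotient_map_eq.
set x' := qrepr _; set y' := qrepr _.
rewrite -(subrK (vjoin x' y) (vjoin x y)) -addrA rpredD //.
  by apply: ideal_solid (modulus_joinBl _ _ _) _; rewrite -opprB rpredN qreprB.
rewrite ![vjoin x' _]vjoinC.
by apply: ideal_solid (modulus_joinBl _ _ _) _; rewrite -opprB rpredN qreprB.
Qed.

Lemma pi_meet x y : pi (vmeet x y) = pi x + pi y - pi (vjoin x y).
Proof. by rewrite vmeetE !quotient_mapD quotient_mapN. Qed.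

Lemma qmeetE p q : qmeet p q = p + q - qjoin p q.
Proof. by rewrite /qmeet pi_meet !qreprK. Qed.

Fact qscaleA a b q : qscale a (qscale b q) = qscale (a * b) q.
Proof.
by have [x <-] := quotient_mapP q; rewrite -!pi_scale scalerA.
Qed.

Fact qscale1 : left_id 1 qscale.
Proof. by move=> q; rewrite /qscale scale1r qreprK. Qed.

Fact qscaleDr : right_distributive qscale +%R.
Proof.
move=> a p q; have [x <-] := quotient_mapP p; have [y <-] := quotient_mapP q.
by rewrite -quotient_mapD -!pi_scale scalerDr quotient_mapD.
Qed.

Fact qscaleDl q : {morph qscale^~ q : a b / a + b}.
Proof.
move=> a b; have [x <-] := quotient_mapP q.
by rewrite -!pi_scale scalerDl quotient_mapD.
Qed.

HB.instance Definition _ := GRing.Zmodule_isLmodule.Build R Q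
  qscaleA qscale1 qscaleDr qscaleDl.

Fact quotient_map_linear : linear pi.
Proof. by move=> a x y; rewrite quotient_mapD pi_scale. Qed.

HB.instance Definition _ :=
  GRing.isLinear.Build R X Q *:%R pi quotient_map_linear.

Lemma pi_scaleE a x : pi (a *: x) = a *: pi x.
Proof. exact: pi_scale. Qed.

Fact qjoinxx p : qjoin p p = p.
Proof. by rewrite /qjoin vjoinxx qreprK. Qed.

Fact qjoinC p q : qjoin p q = qjoin q p.
Proof. by rewrite /qjoin vjoinC. Qed.

Fact qjoinA p q r : qjoin p (qjoin q r) = qjoin (qjoin p q) r.
Proof.
have [x <-] := quotient_mapP p; have [y <-] := quotient_mapP q.
by have [z <-] := quotient_mapP r; rewrite -!pi_join vjoinA.
Qed.

Fact qjoinD2r r p q : qjoin p q + r = qjoin (p + r) (q + r).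
Proof.
have [x <-] := quotient_mapP p; have [y <-] := quotient_mapP q.
have [z <-] := quotient_mapP r.
by rewrite -pi_join -!quotient_mapD -pi_join vjoinD2r.
Qed.

Fact qle_refl : reflexive qle.
Proof. by move=> p; rewrite /qle qjoinxx. Qed.

Fact qle_anti : antisymmetric qle.
Proof.
by move=> p q /andP[/eqP pq /eqP qp]; rewrite -[LHS]qp qjoinC.
Qed.

Fact qle_trans : transitive qle.
Proof.
by move=> q p r /eqP pq /eqP qr; rewrite /qle -qr qjoinA pq.
Qed.

Fact qjoin_le p q r : qle (qjoin p q) r = qle p r && qle q r.
Proof.
rewrite /qle; apply/eqP/andP => [<-|[/eqP pr /eqP qr]].
  rewrite !qjoinA qjoinxx; split=> //.
  by rewrite [qjoin q p]qjoinC -(qjoinA p q q) qjoinxx.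
by rewrite -qjoinA qr pr.
Qed.

Fact qleD2r r p q : qle p q -> qle (p + r) (q + r).
Proof. by move=> /eqP pq; rewrite /qle -qjoinD2r pq. Qed.

Fact qleN p q : qle p q -> qle (- q) (- p).
Proof.
move=> /(qleD2r (- p - q)).
by rewrite addrA subrr add0r [- p - q]addrC addrA subrr add0r.
Qed.

Fact qmeetN p q : qmeet p q = - qjoin (- p) (- q).
Proof.
rewrite qmeetE -[X in X - _]opprK -opprD; congr (- _).
by rewrite addrC qjoinD2r opprD !addrA subrr add0r addrAC subrr add0r qjoinC.
Qed.

Fact qle_meet r p q : qle r (qmeet p q) = qle r p && qle r q.
Proof.
have N a b : qle a b = qle (- b) (- a).
  by apply/idP/idP => /qleN //; rewrite !opprK.
by rewrite N qmeetN opprK qjoin_le -!N.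
Qed.

Fact qleZ a p q : 0 <= a -> qle p q -> qle (a *: p) (a *: q).
Proof.
move=> a0; have [x <-] := quotient_mapP p; have [y <-] := quotient_mapP q.
rewrite /qle -pi_join => /eqP E; rewrite -!pi_scaleE -pi_join vjoinZ //.
by rewrite !pi_scaleE E.
Qed.

HB.instance Definition _ := Lmodule_isVectorLattice.Build R Q
  qle_refl qle_anti qle_trans qle_meet qjoin_le qleD2r qleZ.

Lemma quotient_map_join : {morph pi : x y / vjoin x y}.
Proof. exact: pi_join. Qed.

Lemma quotient_map_meet : {morph pi : x y / vmeet x y}.
Proof. by move=> x y; rewrite pi_meet vmeetE quotient_map_join. Qed.

Lemma pi_modulus x : pi (modulus x) = modulus (pi x).
Proof. by rewrite /modulus pi_join quotient_mapN. Qed.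

Lemma modulus_lift p y : vle (modulus p) (modulus (pi y)) ->
  exists2 x, pi x = p & vle (modulus x) (modulus y).
Proof.
move=> py; exists (vjoin (vmeet (qrepr p) (modulus y)) (- modulus y)).
  have pm : vle p (modulus (pi y)) := vle_trans (vle_modulus p) py.
  have mp : vle (- modulus (pi y)) p.
    by apply: vle_trans (vleN_modulus p); rewrite vleN2.
  rewrite quotient_map_join quotient_map_meet qreprK quotient_mapN pi_modulus.
  rewrite vmeetE (eqP (etrans (esym (vle_eqjoin _ _)) pm)) addrK vjoinC.
  by apply/eqP; rewrite -vle_eqjoin.
rewrite vmodulus_le vle_joinr andbT vjoin_le vmeet_ler /=.
exact: vle_trans (vleN_modulus y) (vle_modulus y).
Qed.

Lemma qnorm_has_inf q : has_inf [set `|x| | x in [set x | pi x = q]].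
Proof.
split; first by have [x xq] := quotient_mapP q; exists `|x|, x.
by exists 0 => _ [x _ <-].
Qed.

Lemma qnorm_le x : qnorm (pi x) <= `|x|.
Proof. by apply: ge_inf; [case: (qnorm_has_inf (pi x))|exists x]. Qed.

Lemma qnorm_lt q e : 0 < e -> exists2 x, pi x = q & `|x| < qnorm q + e.
Proof.
move=> e0; have [_ [x xq <-] xe] := inf_adherent e0 (qnorm_has_inf q).
by exists x.
Qed.

Lemma qnorm_ge0 q : 0 <= qnorm q.
Proof. by apply: lb_le_inf; [case: (qnorm_has_inf q)|move=> _ [x _ <-]]. Qed.

Fact qnormD p q : qnorm (p + q) <= qnorm p + qnorm q.
Proof.
apply/ler_addgt0Pr => e e0; have e2 : 0 < e / 2 by rewrite divr_gt0.
have [x <- xe] := qnorm_lt p e2; have [y <- ye] := qnorm_lt q e2.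
rewrite -quotient_mapD (le_trans (qnorm_le _)) // (le_trans (ler_normD _ _)) //.
by rewrite [e]splitr addrACA lerD // ltW.
Qed.

Fact qnormZ a q : qnorm (a *: q) = `|a| * qnorm q.
Proof.
have le b r : qnorm (b *: r) <= `|b| * qnorm r.
  apply/ler_addgt0Pr => e e0; have b1 : 0 < `|b| + 1 by rewrite ltr_wpDl.
  have [x <- xe] := qnorm_lt r (divr_gt0 e0 b1).
  rewrite -linearZ (le_trans (qnorm_le _)) // normrZ.
  rewrite (le_trans (ler_wpM2l (normr_ge0 b) (ltW xe))) // mulrDr lerD2l.
  by rewrite mulrCA ler_piMr ?ltW // ltr_pdivrMr // mul1r ltrDl.
have [->|a0] := eqVneq a 0.
  rewrite normr0 mul0r scale0r; apply/eqP; rewrite eq_le qnorm_ge0 andbT.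
  by rewrite -quotient_map0 -(normr0 X) qnorm_le.
apply/eqP; rewrite eq_le le /= -ler_pdivlMl ?normr_gt0 // -normfV.
by rewrite -{1}[q](scalerK a0) le.
Qed.

Fact qnorm0_eq0 q : qnorm q = 0 -> q = 0.
Proof.
have [x <-] := quotient_mapP q => x0; rewrite -quotient_map0.
apply/quotient_map_eq; rewrite subr0.
apply: (@ideal_closed _ _ J) => B /nbhs_ballP[e /= e0 eB].
have [y yx] := qnorm_lt (pi x) e0; rewrite x0 add0r => ye.
exists (x - y); split => /=; first by apply/quotient_map_eq.
by apply: eB; rewrite -ball_normE /= opprB addrC subrK.
Qed.

HB.instance Definition _ := Lmodule_isNormed.Build R Q qnormD qnormZ qnorm0_eq0.

Lemma qnormE q : `|q| = inf [set `|x| | x in [set x | pi x = q]].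
Proof. by []. Qed.

Fact quotient_complete (F : set_system Q) :
  ProperFilter F -> cauchy F -> cvg F.
Proof.
move=> FF /cauchyP FC; pose h n : R := 2^-1 ^+ n.
have h0 n : 0 < h n by rewrite exprn_gt0 // invr_gt0.
have /choice[c Fc] n : exists q : Q, F (ball q (h n)) by exact: FC.
have cB n : `|c n.+1 - c n| < h n + h n.
  have [q [/= cq c1q]] := filter_ex (filterI (Fc n) (Fc n.+1)).
  rewrite -!ball_normE /= in cq c1q.
  rewrite -(subrK q (c n.+1)) -addrA (le_lt_trans (ler_normD _ _)) // ltrD //.
    rewrite (lt_le_trans c1q) // /h exprS ler_piMl ?ltW //.
    by rewrite invf_lt1 ?ltr1n.
  by rewrite distrC.
have /choice[z zP] n : exists z, pi z = c n.+1 - c n /\ `|z| < h n + h n + h n.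
  have [z zc zh] := qnorm_lt (c n.+1 - c n) (h0 n).
  by exists z; split => //; rewrite (lt_trans zh) // ltrD2r; exact: cB.
pose x n := qrepr (c 0%N) + series z n.
have px n : pi (x n) = c n.
  elim: n => [|n IH]; rewrite /x.
    by rewrite /series /= big_geq // addr0 qreprK.
  rewrite /series /= big_nat_recr //= addrA quotient_mapD.
  by rewrite -/(series z n) -/(x n) IH (zP n).1 addrC subrK.
have cz : cvgn (series z).
  apply: normed_cvg.
  apply: (@series_le_cvg R _ (geometric 3 2^-1)) => [n|n|n|].
  - exact: normr_ge0.
  - by rewrite /= mulr_ge0 // exprn_ge0 // invr_ge0.
  - rewrite /= (le_trans (ltW (zP n).2)) // /h.
    by rewrite mulr_natl -[_ ^+ n]/(h n) mulrSr mulr2n.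
  - apply: is_cvg_geometric_series.
    by rewrite ger0_norm ?invr_ge0 // invf_lt1 ?ltr1n.
have [l xl] : exists l : X, x n @[n --> \oo] --> l.
  exists (qrepr (c 0%N) + limn (series z)).
  by apply: cvgD => //; exact: cvg_cst.
have hcvg : h @ \oo --> (0 : R).
  by apply: cvg_expr; rewrite ger0_norm ?invr_ge0 // invf_lt1 ?ltr1n.
apply/cvg_ex; exists (pi l); apply/cvg_ballP => e e0.
have e2 : 0 < e / 2 by rewrite divr_gt0.
have /cvgrPdist_lt/(_ _ e2) [N _ HN] := xl.
have /cvgrPdist_lt/(_ _ e2) [M _ HM] := hcvg.
pose n := maxn N M.
have := HN n (leq_maxl _ _); have := HM n (leq_maxr _ _) => /=.
rewrite sub0r normrN gtr0_norm // => hn ln.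
apply: filterS (Fc n) => q; rewrite -!ball_normE /= => cq.
rewrite -(subrK (c n) (pi l)) -addrA (le_lt_trans (ler_normD _ _)) //.
rewrite [e]splitr ltrD // ?(lt_trans cq) //.
by rewrite (le_lt_trans _ ln) // -px -quotient_mapN -quotient_mapD qnorm_le.
Qed.

HB.instance Definition _ := Uniform_isComplete.Build Q quotient_complete.

Fact qnorm_mono (p q : Q) : vle (modulus p) (modulus q) -> `|p| <= `|q|.
Proof.
move=> pq; apply/ler_addgt0Pr => e e0.
have [y yq ye] := qnorm_lt q e0; rewrite -yq in pq.
have [x xp xy] := modulus_lift pq.
rewrite (le_trans _ (ltW ye)) // (le_trans _ (vnorm_mono _ _ xy)) //.
by rewrite -xp qnorm_le.
Qed.

HB.instance Definition _ := VectorLattice_isBanachLattice.Build R Q qnorm_mono.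

End Quotient.

Section Operators.
Variable R : realType.

Definition bounded_operator (E F : normedModType R) (T : {linear E -> F}) :=
  exists M : R, forall x, `|T x| <= M * `|x|.

(* [sup] is the real supremum, meaningful when [T] is bounded. *)
Definition opnorm (E F : normedModType R) (T : {linear E -> F}) : R :=
  sup [set `|T x| | x in [set x : E | `|x| <= 1]].

Definition banach_lattice_hom (X Y : banachLatticeType R)
    (T : {linear X -> Y}) : Prop :=
  [/\ bounded_operator T,
      {morph T : x y / vjoin x y} &
      {morph T : x y / vmeet x y}].

Lemma quotient_map_hom (X : banachLatticeType R) (J : closedIdeal X) :
  banach_lattice_hom (quotient_map J).
Proof.
split; [|exact: quotient_map_join|exact: quotient_map_meet].
by exists 1 => x; rewrite mul1r; exact: qnorm_le.
Qed.

Definition lambda_projective (lambda : R) (P : banachLatticeType R) : Prop :=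
  forall (X : banachLatticeType R) (J : closedIdeal X)
    (T : {linear P -> ideal_quotient J}),
    banach_lattice_hom T ->
    exists T' : {linear P -> X},
      [/\ banach_lattice_hom T',
          forall p, T p = quotient_map J (T' p) &
          opnorm T' <= lambda * opnorm T].

Definition infty_projective (P : banachLatticeType R) : Prop :=
  exists2 lambda : R, 1 < lambda & lambda_projective lambda P.

(* [(F, u)] is the free Banach lattice generated by [E]. *)
Definition is_FBL (E : completeNormedModType R) (F : banachLatticeType R)
    (u : {linear E -> F}) : Prop :=
  bounded_operator u /\
  forall (Y : banachLatticeType R) (T : {linear E -> Y}),
    bounded_operator T ->
    exists S : {linear F -> Y},
      [/\ banach_lattice_hom S,
          forall x, S (u x) = T x,
          opnorm S = opnorm T &
          forall S' : {linear F -> Y},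
            banach_lattice_hom S' -> (forall x, S' (u x) = T x) -> S' =1 S].

Definition weakly_converges (E : normedModType R) (x : nat -> E) (l : E) :=
  forall f : {linear E -> R^o}, bounded_operator f ->
    f (x n) @[n --> \oo] --> f l.

Definition schur_property (E : normedModType R) : Prop :=
  forall x : nat -> E,
    (exists l : E, weakly_converges x l) -> cvg (x n @[n --> \oo]).

End Operators.

(* Main.v *)
(* Call a function m : E -> R dominated if |m d| <= |d| for all d, and let X be
   the Banach lattice of the functions f on dominated functions that are limits
   of functions of finitely many coordinates, normed by the suprema of
   sum |f m_i| over the finite families with sum |m_i d| <= |d| for all d. Let J
   be the ideal of those vanishing at the linear m. Modulo J the evaluations
   delta_x are linear in x, so E maps boundedly into X / J. By freeness and
   projectivity this map lifts to a bounded linear L : E -> X with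
   (L x)(g) = g x for every linear g.
   Suppose (z_n) is weakly null with |z_n| >= c. Up to a small error L z_n only
   depends on the coordinates in a finite set G_n. Choose inductively n_k and
   functionals g_k, bounded away from 0 at z_(n_k) and tiny on
   G_(n_0), ..., G_(n_(k-1)), and set g_k to 0 outside G_(n_k). The truncations
   q_k form an admissible family, so x |-> ((L x)(q_k))_k is bounded from E to
   l_1, while (L z_(n_k))(q_k) stays away from 0. This contradicts the Schur
   property of l_1. *)
From HB Require Import structures.
Require Import Defs.
From mathcomp Require Import all_boot all_order all_algebra.
From mathcomp Require Import all_classical all_reals.
From mathcomp Require Import topology normedtype sequences.
From mathcomp Require Import ring lra.

Set Implicit Arguments.
Unset Strict Implicit.
Unset Printing Implicit Defensive.

Import Order.TTheory GRing.Theory Num.Theory.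
Import numFieldNormedType.Exports.

Local Open Scope classical_set_scope.
Local Open Scope ring_scope.

Lemma linear_of (R : realType) (V W : lmodType R) (f : V -> W) :
  linear f -> exists g : {linear V -> W}, g =1 f.
Proof.
move=> fl; pose g : {linear V -> W} := HB.pack f (GRing.isLinear.Build R V W *:%R f fl).
by exists g.
Qed.

(** * The Hahn-Banach theorem, via minimal sublinear functionals *)

Section HahnBanach.
Variables (R : realType) (V : lmodType R).
Implicit Types (p q : V -> R) (x y : V).

Definition sublinear p : Prop :=
  (forall x y, p (x + y) <= p x + p y) /\
  (forall (a : R) x, 0 <= a -> p (a *: x) <= a * p x).

Lemma sublinear0 p : sublinear p -> p 0 = 0.
Proof.
move=> [pD pZ]; apply/eqP; rewrite eq_le.
have := pZ 0 0 (lexx _); rewrite scale0r mul0r => -> /=.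
by have := pD 0 0; rewrite addr0 lerDl.
Qed.

Lemma sublinearZ p a x : sublinear p -> 0 <= a -> p (a *: x) = a * p x.
Proof.
move=> sp; rewrite le_eqVlt => /predU1P[<-|a0].
  by rewrite scale0r mul0r sublinear0.
have pZ := proj2 sp; apply/eqP; rewrite eq_le pZ ?(ltW a0) //=.
rewrite -ler_pdivlMl // -[leLHS](congr1 p (scalerK (lt0r_neq0 a0) x)).
by rewrite pZ // invr_ge0 ltW.
Qed.

Lemma sublinearN p x : sublinear p -> - p (- x) <= p x.
Proof.
move=> sp; case: (sp) => pD _.
by rewrite lerNl -subr_ge0 opprK addrC -(sublinear0 sp) -(subrr x) pD.
Qed.

(** Serves both the infimum over [t] in [reduce] and the infimum over a chain in Zorn's lemma. The
    index [k] may depend on the points. *)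
Lemma sublinear_inf (I : Type) (A : set I) (q : I -> V -> R) :
  A !=set0 -> (forall x, has_lbound [set q i x | i in A]) ->
  (forall i j x y, A i -> A j ->
     exists2 k, A k & q k (x + y) <= q i x + q j y) ->
  (forall i (a : R) x, A i -> 0 < a ->
     exists2 k, A k & q k (a *: x) <= a * q i x) ->
  (exists2 k, A k & q k 0 <= 0) ->
  sublinear (fun x => inf [set q i x | i in A]).
Proof.
move=> A0 lA qD qZ [k0 Ak0 q0].
have hi x : has_inf [set q i x | i in A].
  by split => //; case: A0 => i Ai; exists (q i x), i.
have ile i x : A i -> inf [set q i x | i in A] <= q i x.
  by move=> Ai; apply: ge_inf; [case: (hi x)|exists i].
split=> [x y|a x].
  apply/ler_addgt0Pr => e e0; have e2 : 0 < e / 2 by rewrite divr_gt0.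
  have [_ [i Ai <-] /ltW ie] := inf_adherent e2 (hi x).
  have [_ [j Aj <-] /ltW je] := inf_adherent e2 (hi y).
  have [k Ak qk] := qD i j x y Ai Aj.
  rewrite (le_trans (ile k _ Ak)) // (le_trans qk) // (le_trans (lerD ie je)) //.
  by rewrite addrACA -splitr.
rewrite le_eqVlt => /predU1P[<-|a0].
  by rewrite scale0r mul0r (le_trans (ile _ _ Ak0)).
rewrite mulrC -ler_pdivrMr //; apply: lb_le_inf; first by case: (hi x).
move=> _ [i Ai <-]; rewrite ler_pdivrMr // mulrC.
by have [k Ak qk] := qZ i a x Ai a0; rewrite (le_trans (ile k _ Ak)).
Qed.

(* The largest sublinear functional below [q] taking the value [- q y] at [- y]. *)
Definition reduce q y x : R := inf [set q (x + t *: y) - t * q y | t in >= 0].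

(** Subadditivity on [t *: y = (x + t *: y) + (- x)] gives the lower bound [- q (- x)]. *)
Lemma reduce_has_lbound q y x :
  sublinear q -> has_lbound [set q (x + t *: y) - t * q y | t in >= 0].
Proof.
move=> sq; exists (- q (- x)) => _ [t /= t0 <-].
rewrite -(sublinearZ _ sq) // lerBrDr addrC lerBlDr.
by case: sq => qD _; have := qD (x + t *: y) (- x); rewrite addrAC subrr add0r.
Qed.

Lemma reduce_le_at q y x t :
  sublinear q -> 0 <= t -> reduce q y x <= q (x + t *: y) - t * q y.
Proof. by move=> sq t0; apply: ge_inf; [exact: reduce_has_lbound|exists t]. Qed.

Lemma reduce_le q y x : sublinear q -> reduce q y x <= q x.
Proof.
move=> sq; have := reduce_le_at y x sq (lexx 0).
by rewrite scale0r addr0 mul0r subr0.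
Qed.

Lemma reduceN q y : sublinear q -> reduce q y (- y) <= - q y.
Proof.
move=> sq; have := reduce_le_at y (- y) sq ler01.
by rewrite scale1r addNr sublinear0 // sub0r mul1r.
Qed.

Lemma reduce_sublinear q y : sublinear q -> sublinear (reduce q y).
Proof.
move=> sq; have [qD qZ] := sq.
apply: (@sublinear_inf R (fun t : R => 0 <= t) (fun t x => q (x + t *: y) - t * q y)).
- by exists 0 => /=.
- by move=> x; exact: reduce_has_lbound.
- move=> s t x x' /= s0 t0; exists (s + t); first exact: addr_ge0.
  rewrite scalerDl mulrDl opprD addrACA [leRHS]addrACA lerD2r.
  exact: qD.
- move=> t a x /= t0 a0; exists (a * t); first by rewrite mulr_ge0 // ltW.
  by rewrite -scalerA -scalerDr mulrBr -mulrA lerD2r qZ // ltW.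
- by exists 0 => //=; rewrite scale0r addr0 mul0r subr0 sublinear0.
Qed.

(** Zorn's lemma: the infimum of a chain is finite because each member is at least [- p (- x)] at
    [x]. *)
Lemma minimal_sublinear p : sublinear p ->
  exists q, [/\ sublinear q, forall x, q x <= p x &
    forall q', sublinear q' -> (forall x, q' x <= q x) -> forall x, q x <= q' x].
Proof.
move=> sp; pose T := {q : V -> R | sublinear q /\ forall x, q x <= p x}.
pose p0 : T := exist _ p (conj sp (fun=> lexx _)).
(* The order is reversed, so that a maximal element is a minimal functional. *)
pose below (s t : T) := `[< forall x, sval t x <= sval s x >].
have [||A totA|[q [sq qp]] qmin] := @ZL_preorder T p0 below.
- by move=> t; apply/asboolP.
- move=> r s t /asboolP rs /asboolP st; apply/asboolP => x.
  exact: le_trans (rs x).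
- have [A0|/set0P A0] := eqVneq A set0.
    by exists p0 => s; rewrite A0.
  pose q x := inf [set sval s x | s in A].
  have lA x : has_lbound [set sval s x | s in A].
    exists (- p (- x)) => _ [[s [ss sp']] /= _ <-].
    by rewrite (le_trans _ (sublinearN x ss)) // lerN2.
  have sq : sublinear q.
    apply: sublinear_inf => // [s t x y As At|s a x As a0|].
    - have [/asboolP st|/asboolP ts] := totA _ _ As At.
        exists t => //; case: t {At} st => t [[tD _] _] /= st.
        by rewrite (le_trans (tD _ _)) // lerD2r.
      exists s => //; case: s {As} ts => s [[sD _] _] /= ts.
      by rewrite (le_trans (sD _ _)) // lerD2l.
    - by exists s => //; case: s {As} => s [[_ sZ] _] /=; rewrite sZ // ltW.
    - case: A0 => s As; exists s => //.
      by case: s {As} => s [ss _] /=; rewrite sublinear0.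
  have qle s x : A s -> q x <= sval s x.
    by move=> As; apply: ge_inf => //; exists s.
  have qp x : q x <= p x.
    by case: A0 => s As; rewrite (le_trans (qle s x As)) //; case: s {As} => s [].
  by exists (exist _ q (conj sq qp)) => s As; apply/asboolP => x; exact: qle.
- exists q; split => // q' sq' q'q.
  have q'p x : q' x <= p x by exact: le_trans (qp x).
  by have /asboolP := qmin (exist _ q' (conj sq' q'p)) (introT (asboolP _) q'q).
Qed.

(** Minimality of [q] gives [q <= reduce q y], hence [q (- y) <= - q y]; an odd sublinear functional
    is linear. *)
Lemma dominated_linear p : sublinear p ->
  exists g : {linear V -> R^o}, forall x, g x <= p x.
Proof.
move=> /minimal_sublinear[q [sq qp qmin]]; have [qD qZ] := sq.
have qN y : q (- y) = - q y.
  apply/eqP; rewrite eq_le lerNl sublinearN // andbT.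
  apply: le_trans (reduceN y sq).
  by apply: qmin => [|x]; [exact: reduce_sublinear|exact: reduce_le].
have qZ' a x : q (a *: x) = a * q x.
  have [a0|a0] := leP 0 a; first exact: sublinearZ.
  rewrite -[a]opprK scaleNr qN mulNr; congr (- _).
  by rewrite (sublinearZ _ sq) // oppr_ge0 ltW.
have ql : linear (q : V -> R^o).
  move=> a x y; rewrite -[_ *: q x]/(a * q x) -qZ'.
  apply/eqP; rewrite eq_le qD /= -[leRHS]opprK -qN opprD lerNr.
  by rewrite (le_trans (qD _ _)) // !qN -opprD.
have [g gE] := linear_of ql.
by exists g => x; rewrite gE.
Qed.

End HahnBanach.

(** Domination by the norm reduced at [x], instead of the norm itself, forces [g (- x) <= - |x|]. *)
Lemma norming_functional (R : realType) (E : normedModType R) (x : E) :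
  exists g : {linear E -> R^o}, (forall y, `|g y| <= `|y|) /\ g x = `|x|.
Proof.
have sn : sublinear (fun y : E => `|y|).
  by split=> [|a y a0]; [exact: ler_normD|rewrite normrZ ger0_norm].
have [g gle] := dominated_linear (reduce_sublinear x sn).
have gn y : g y <= `|y| by exact: le_trans (reduce_le x y sn).
exists g; split=> [y|].
  by rewrite ler_norml gn andbT lerNl -linearN -(normrN y) gn.
apply/eqP; rewrite eq_le gn /= -lerN2 -linearN.
exact: le_trans (gle _) (reduceN x sn).
Qed.

(** Dependent choice in which each term sees all earlier ones; both gliding humps below use it. *)
Lemma choose_history (T : Type) (P : seq T -> T -> Prop) :
  (forall s, exists t, P s t) ->
  exists a : nat -> T, forall k, P (mkseq a k) (a k).
Proof.
move=> /choice[next nextP].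
pose hist k := iter k (fun s => rcons s (next s)) [::].
exists (next \o hist) => k; rewrite /=.
suff -> : mkseq (next \o hist) k = hist k by exact: nextP.
by elim: k => // k IH; rewrite mkseqS IH.
Qed.

Lemma filter_forall_seq (T : Type) (I : eqType) (F : set_system T)
    (P : I -> T -> Prop) (s : seq I) :
  Filter F -> (forall i, i \in s -> F (P i)) ->
  F [set t | forall i, i \in s -> P i t].
Proof.
move=> FF; elim: s => [|j s IH] Ps; first by apply: filterE => t i.
have Pj : F (P j) by apply: Ps; rewrite mem_head.
have {}IH : F [set t | forall i, i \in s -> P i t].
  by apply: IH => i si; apply: Ps; rewrite inE si orbT.
apply: filterS2 Pj IH => t Pjt Pst i.
by rewrite inE => /predU1P[->//|/Pst].
Qed.

(** * Weakly null sequences: Schur's theorem for l_1 and functionals small on finite sets *)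

Section WeaklyNull.
Variables (R : realType) (E : normedModType R).
Implicit Types (z : nat -> E).

Lemma weakly_null_near z (f : {linear E -> R^o}) (e : R) :
  weakly_converges z 0 -> bounded_operator f -> 0 < e ->
  \forall n \near \oo, `|f (z n)| < e.
Proof.
move=> z0 fb e0; have /cvgrPdist_lt/(_ _ e0) := z0 f fb.
by rewrite linear0; apply: filterS => n; rewrite sub0r normrN.
Qed.

Lemma weakly_converges_subseq z l (n : nat -> nat) :
  (forall k, (k <= n k)%N) -> weakly_converges z l ->
  weakly_converges (z \o n) l.
Proof.
move=> nk zl f fb; apply: (@cvg_comp _ _ _ n (f \o z) _ \oo); last exact: zl.
move=> A [N _ NA]; exists N => // k /= Nk; apply: NA => /=.
exact: leq_trans (nk k).
Qed.

(** Each kept term [f (a i)] opens the block of indices from [a i] up to [a i.+1], whose other terms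
    are nonnegative. *)
Lemma sum_subseq_le (f : nat -> R) (a : nat -> nat) m n :
  (forall k, 0 <= f k) -> {homo a : i j / (i < j)%N} -> (m <= n)%N ->
  \sum_(m <= i < n) f (a i) <= \sum_(a m <= j < a n) f j.
Proof.
move=> f0 ai; elim: n => [|n IH].
  by rewrite leqn0 => /eqP->; rewrite !big_geq.
rewrite leq_eqVlt => /predU1P[->|]; first by rewrite !big_geq.
rewrite ltnS => mn; rewrite big_nat_recr //=.
have amn : (a m <= a n)%N by move: mn; rewrite leq_eqVlt => /predU1P[->//|/ai/ltnW].
have ann : (a n < a n.+1)%N by exact: ai.
rewrite (big_cat_nat amn (ltnW ann)) /= lerD ?IH //.
by rewrite big_ltn // lerDl sumr_ge0.
Qed.

(* Schur's theorem for l_1, by a gliding hump argument: the functionals [h k]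
   are the coordinates of an operator from [E] to l_1. *)
Lemma schur_l1 (h : nat -> {linear E -> R^o}) (C c : R) z :
  (forall x N, \sum_(0 <= k < N) `|h k x| <= C * `|x|) ->
  weakly_converges z 0 -> 0 < c -> ~ (forall k, c <= h k (z k)).
Proof.
move=> hC z0 c0 hz; have c4 : 0 < c / 4 by rewrite divr_gt0.
have hb k : bounded_operator (h k).
  exists C => x; apply: le_trans (hC x k.+1).
  by rewrite big_nat_recr //= lerDr sumr_ge0.
have hcvg x : cvgn (series (fun k => `|h k x| : R^o)).
  apply: nondecreasing_is_cvgn.
    by apply/nondecreasing_seqP => n; rewrite /series /= big_nat_recr //= lerDl.
  by exists (C * `|x|) => _ [n _ <-]; exact: hC.
have tail i : \forall k \near \oo,
    forall N, \sum_(k <= j < N) `|h j (z i)| <= c / 4.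
  have /cauchy_cvgP/cauchy_seriesP/(_ _ c4) := hcvg (z i).
  move=> [[A B] /= [[N1 _ N1A] [N2 _ N2B]] AB].
  exists (maxn N1 N2) => // k /=; rewrite geq_max => /andP[k1 k2] N.
  have [Nk|kN] := leqP N k; first by rewrite big_geq // ltW.
  apply: le_trans (ler_norm _) (ltW _); apply: (AB (k, N)); split => /=.
    exact: N1A.
  by apply: N2B => /=; rewrite (leq_trans k2) // ltnW.
(* [s] lists the indices already chosen: their functionals are small at the new [z k], and their
   vectors have small coordinates from [k] on. *)
pose P (s : seq nat) k := [/\ forall i, i \in s -> (i < k)%N,
  \sum_(i <- s) `|h i (z k)| <= c / 4 &
  forall i, i \in s -> forall N, \sum_(k <= j < N) `|h j (z i)| <= c / 4].
have [s|a aP] := @choose_history nat P.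
  have l1 : \forall k \near \oo, forall i, i \in s -> (i < k)%N.
    by apply: filter_forall_seq => i _; exact: nbhs_infty_gt.
  (* The successor keeps the divisor positive for the empty history. *)
  have e0 : 0 < c / 4 / (size s).+1%:R by rewrite divr_gt0.
  have l2 : \forall k \near \oo, forall i, i \in s ->
      `|h i (z k)| < c / 4 / (size s).+1%:R.
    by apply: filter_forall_seq => i _; exact: weakly_null_near.
  have l3 : \forall k \near \oo, forall i, i \in s ->
      forall N, \sum_(k <= j < N) `|h j (z i)| <= c / 4.
    by apply: filter_forall_seq => i _; exact: tail.
  have [k [[k1 k2] k3]] := filter_ex (filterI (filterI l1 l2) l3).
  exists k; split => //; rewrite big_seq_cond.
  rewrite (le_trans (@ler_sum _ _ s _ _ (fun=> c / 4 / (size s).+1%:R) _)) //.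
    by move=> i; rewrite andbT => /k2/ltW.
  rewrite -big_seq_cond big_const_seq count_predT iter_addr_0 -[leLHS]mulr_natr.
  by rewrite mulrAC ler_pdivrMr // ler_pM2l // ler_nat.
have ai : {homo a : i j / (i < j)%N}.
  move=> i j ij; have [+ _ _] := aP j; apply.
  by apply/mapP; exists i => //; rewrite mem_iota.
have ak k : (k <= a k)%N.
  by elim: k => // k IH; rewrite (leq_ltn_trans IH) // ai.
have aC x N : \sum_(0 <= k < N) `|h (a k) x| <= C * `|x|.
  rewrite (le_trans (@sum_subseq_le (fun j => `|h j x|) _ _ _ _ ai (leq0n N))) //.
  rewrite (le_trans _ (hC x (a N))) // [leRHS](big_cat_nat (leq0n (a 0%N))) /=.
    by rewrite lerDr sumr_ge0.
  by have [->|N0] := posnP N; rewrite // ltnW // ai.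
(* The sum of the chosen coordinates is a functional bounded by [C]; its values at the [z (a N)]
   will not tend to 0. *)
pose H x := [series h (a k) x : R^o]_k.
have Hcvg x : cvgn (H x).
  apply: (@normed_cvg R R^o).
  change (cvgn (series (fun k => `|h (a k) x| : R^o))).
  apply: nondecreasing_is_cvgn.
    by apply/nondecreasing_seqP => n; rewrite /series /= big_nat_recr //= lerDl.
  by exists (C * `|x|) => _ [n _ <-]; exact: aC.
have [|g gE] := @linear_of R E R^o (fun x => limn (H x)).
  move=> b x y; apply: cvg_lim => //.
  have -> : H (b *: x + y) = b *: H x + H y.
    apply/funext => n; rewrite /H /series /= -[RHS]/(b * _ + _) mulr_sumr -big_split.
    by apply: eq_bigr => i _; rewrite linearP.
  by apply: cvgD; [apply: cvgZr|]; exact: Hcvg.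
have gb : bounded_operator g.
  exists C => x; rewrite gE.
  have /cvg_norm lx := Hcvg x.
  rewrite -(cvg_lim _ lx) //; apply: limr_le; first by apply/cvg_ex; eexists; exact: lx.
  apply: nearW => n; rewrite (le_trans _ (aC x n)) //.
  exact: ler_norm_sum.
have c2 : 0 < c / 2 by rewrite divr_gt0.
(* Weak nullity makes the value at [z (a N)] less than [c / 2], but the diagonal term is at least
   [c] and the terms before and after it contribute at least [- (c / 4)] each. *)
have [N _ /(_ _ (ak N))] := weakly_null_near z0 gb c2.
apply/negP; rewrite -leNgt (le_trans _ (ler_norm _)) // gE.
apply: limr_ge; first exact: Hcvg.
exists N.+1 => // n /= Nn; rewrite /H /series /=.
rewrite (big_cat_nat (leq0n N)) /=; last by rewrite ltnW.
rewrite [X in _ + X]big_ltn //.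
have [_ hN _] := aP N; rewrite big_map in hN.
have hN' : - (c / 4) <= \sum_(0 <= i < N) h (a i) (z (a N)).
  rewrite lerNl (le_trans _ hN) // (le_trans (ler_norm _)) // normrN.
  by rewrite /index_iota subn0; exact: ler_norm_sum.
have tN : - (c / 4) <= \sum_(N.+1 <= i < n) h (a i) (z (a N)).
  rewrite lerNl (le_trans (ler_norm _)) // normrN (le_trans (ler_norm_sum _ _ _)) //.
  rewrite (le_trans (@sum_subseq_le (fun j => `|h j (z (a N))|) _ _ _ _ ai Nn)) //.
  have [_ _] := aP N.+1; apply; apply/mapP; exists N => //.
  by rewrite mem_iota /= add0n.
have add3 (A B D : R) :
    - (c / 4) <= A -> c <= B -> - (c / 4) <= D -> c / 2 <= A + (B + D).
  by move=> ? ? ?; lra.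
exact: add3.
Qed.

(** Compactness of [[- B, B]] gives a cluster point, which for an ultrafilter is a limit. *)
Lemma ultra_limit (T : Type) (U : set_system T) (f : T -> R) (B : R) :
  UltraFilter U -> (forall t, `|f t| <= B) ->
  exists l, forall e, 0 < e -> U [set t | `|f t - l| < e].
Proof.
move=> UU fB.
have UB : (f @ U) `[- B, B]%classic.
  by rewrite /fmap /=; apply: filterE => t; rewrite /= in_itv /= -ler_norml.
have [l [_ cl]] := @segment_compact R (- B) B _ _ UB.
exists l => e e0; have [//|nA] := in_ultra_setVsetC [set t | `|f t - l| < e] UU.
have [y []] := cl (~` [set y | `|y - l| < e]) _ nA (nbhsx_ballx l e e0).
by rewrite -ball_normE /= distrC.
Qed.

(* The functional is a difference of two norming functionals of terms of [z]
   that are close on [G]; such terms exist because bounded sequences converge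
   along an ultrafilter. *)
Lemma almost_annihilating_functional z (c e : R) (G : seq E) (N : nat) :
  weakly_converges z 0 -> 0 < c -> (forall n, c <= `|z n|) -> 0 < e ->
  exists n (g : {linear E -> R^o}), [/\ (N <= n)%N,
    forall x, `|g x| <= `|x| / 2, c / 8 <= g (z n) &
    forall d, d \in G -> `|g d| <= e * `|d|].
Proof.
move=> z0 c0 cz e0.
have [phi phiP] := choice (fun n => norming_functional (z n)).
have [U [UU sU]] := @ultraFilterLemma nat \oo _.
have /choice[l lP] d : exists l, forall e, 0 < e -> U [set n | `|phi n d - l| < e].
  by apply: (@ultra_limit _ _ _ `|d|) => n; have [] := phiP n.
(* Zero vectors are removed because the strict bound fails at them. *)
have UG : U [set n | forall d, d \in [seq d <- G | d != 0] ->
    `|phi n d - l d| < 2 * e * `|d|].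
  apply: filter_forall_seq => d; rewrite mem_filter => /andP[d0 _].
  by apply: lP; rewrite !mulr_gt0 // normr_gt0.
(* The subtracted index [n0] is fixed first; [n] is then taken where [phi n0] is small at [z n]. *)
have [n0 n0G] := filter_ex UG.
have c2 : 0 < c / 2 by rewrite divr_gt0.
have phib : bounded_operator (phi n0).
  by exists 1 => x; rewrite mul1r; have [] := phiP n0.
have Un : U [set n | (N <= n)%N] by apply: sU; exact: nbhs_infty_ge.
have Uz : U [set n | `|phi n0 (z n)| < c / 2].
  by apply: sU; exact: weakly_null_near.
have [n [[nG Nn] zn]] := filter_ex (filterI (filterI UG Un) Uz).
(* The factor 1/4 turns the norm bound 2 of the difference into 1/2, its lower bound [c - c / 2] at
   [z n] into [c / 8], and [4 * e * |d|] on [G] into [e * |d|]. *)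
have [|g gE] := @linear_of R E R^o (fun x => 4^-1 * (phi n x - phi n0 x)).
  move=> a x y.
  have phiD k : phi k (a *: x + y) = a * phi k x + phi k y by rewrite linearP.
  by rewrite !phiD -[RHS]/(a * _ + _); ring.
exists n, g; split => // [x||d dG].
- rewrite gE normrM ger0_norm ?invr_ge0 //.
  have := ler_normB (phi n x) (phi n0 x).
  have := (phiP n).1 x; have := (phiP n0).1 x.
  by move=> *; lra.
- rewrite gE (phiP n).2; have := cz n.
  by have := le_lt_trans (ler_norm _) zn; lra.
- have [->|d0] := eqVneq d 0; first by rewrite linear0 normr0 normr0 mulr0.
  have dG' : d \in [seq d <- G | d != 0] by rewrite mem_filter d0.
  have := n0G _ dG'; have := nG _ dG'.
  rewrite gE normrM ger0_norm ?invr_ge0 // => h1 h2.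
  have := ler_distD (l d) (phi n d) (phi n0 d).
  by rewrite [`|l d - _|]distrC => h3; lra.
Qed.

End WeaklyNull.

(** * The Banach lattice of finitary functions on dominated functions *)

Section FunctionLattice.
Variables (R : realType) (E : normedModType R).

(* The dominated functions extend the unit ball of the dual of [E]: a domfun
   need not be linear. *)
Definition domfun : Type := {m : E -> R | forall d, `|m d| <= `|d|}.

(** For linear members this is, by homogeneity, the constraint in the formula for the norm of
    [FBL[E]]. *)
Definition admissible (s : seq domfun) : Prop :=
  forall d, \sum_(m <- s) `|sval m d| <= `|d|.

Definition abs_sum (f : domfun -> R^o) (s : seq domfun) : R :=
  \sum_(m <- s) `|f m|.

Definition abs_sum_bounded (f : domfun -> R^o) : Prop :=
  exists B, forall s, admissible s -> abs_sum f s <= B.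

(* Uniform continuity for the topology of agreement on finite subsets of [E]. *)
Definition finitary (f : domfun -> R^o) : Prop :=
  forall e : R, 0 < e -> exists G : seq E, forall m m' : domfun,
    {in G, sval m =1 sval m'} -> `|f m - f m'| <= e.

Definition latfun_pred : {pred (domfun -> R^o)} :=
  fun f => `[< abs_sum_bounded f /\ finitary f >].

Lemma latfun_predP f : reflect (abs_sum_bounded f /\ finitary f) (f \in latfun_pred).
Proof. exact: asboolP. Qed.

Lemma latfun_submod : submod_closed latfun_pred.
Proof.
split.
  apply/latfun_predP; split.
    by exists 0 => s _; rewrite /abs_sum big1 // => m _; rewrite normr0.
  by move=> e e0; exists [::] => m m' _; rewrite subrr normr0 ltW.
move=> a f g /latfun_predP[[Bf fB] ff] /latfun_predP[[Bg gB] fg].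
apply/latfun_predP; split.
  exists (`|a| * Bf + Bg) => s sa.
  rewrite (@le_trans _ _ (`|a| * abs_sum f s + abs_sum g s)) //; last first.
    by rewrite lerD ?ler_wpM2l ?fB ?gB.
  rewrite /abs_sum mulr_sumr -big_split ler_sum //= => m _.
  by rewrite (le_trans (ler_normD _ _)) // normrM.
move=> e e0.
have a1 : 0 < `|a| + 1 by rewrite ltr_wpDl.
have [G1 H1] : exists G : seq E, forall m m' : domfun,
    {in G, sval m =1 sval m'} -> `|f m - f m'| <= e / 2 / (`|a| + 1).
  by apply: ff; rewrite !divr_gt0.
have [G2 H2] : exists G : seq E, forall m m' : domfun,
    {in G, sval m =1 sval m'} -> `|g m - g m'| <= e / 2.
  by apply: fg; rewrite divr_gt0.
exists (G1 ++ G2) => m m' mm'.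
have /H1 h1 : {in G1, sval m =1 sval m'}.
  by move=> d dG; apply: mm'; rewrite mem_cat dG.
have /H2 h2 : {in G2, sval m =1 sval m'}.
  by move=> d dG; apply: mm'; rewrite mem_cat dG orbT.
have -> : (a *: f + g) m - (a *: f + g) m' = a * (f m - f m') + (g m - g m').
  by rewrite mulrBr -[LHS]/(a * f m + g m - (a * f m' + g m')) opprD addrACA.
rewrite (le_trans (ler_normD _ _)) // [e]splitr lerD //.
rewrite normrM (le_trans (ler_wpM2l _ h1)) // mulrCA ler_piMr ?ltW ?divr_gt0 //.
by rewrite ltr_pdivrMr // mul1r ltrDl.
Qed.

HB.instance Definition _ :=
  GRing.isSubmodClosed.Build R (domfun -> R^o) latfun_pred
    (GRing.submod_closed_semi latfun_submod).

Record latfun := LatFun { latfun_val :> domfun -> R^o; _ : latfun_val \in latfun_pred }.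

HB.instance Definition _ := [isSub for latfun_val].
HB.instance Definition _ := [Choice of latfun by <:].
HB.instance Definition _ := [SubChoice_isSubLmodule of latfun by <:].

Implicit Types f g h : latfun.

Lemma latfun_ext f g : (forall m, f m = g m) -> f = g.
Proof. by move=> fg; apply/val_inj/funext. Qed.

Lemma latfunD f g m : (f + g) m = f m + g m. Proof. by []. Qed.
Lemma latfunB f g m : (f - g) m = f m - g m. Proof. by []. Qed.
Lemma latfunZ a f m : (a *: f) m = a * f m. Proof. by []. Qed.

(** Serves maximum and minimum: both are bounded by the sum of the absolute values and do not expand
    the larger of the two errors. *)
Lemma latfun_op_pred (op : R -> R -> R) :
  (forall x y : R, `|op x y| <= `|x| + `|y|) ->
  (forall x y x' y' e : R, `|x - x'| <= e -> `|y - y'| <= e ->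
    `|op x y - op x' y'| <= e) ->
  forall f g, (fun m => op (f m) (g m) : R^o) \in latfun_pred.
Proof.
move=> opB opC [f /= /latfun_predP[[Bf fB] ff]] [g /= /latfun_predP[[Bg gB] fg]].
apply/latfun_predP; split.
  exists (Bf + Bg) => s sa; rewrite (le_trans _ (lerD (fB s sa) (gB s sa))) //.
  by rewrite -big_split ler_sum.
move=> e e0; have [[G1 H1] [G2 H2]] := (ff e e0, fg e e0).
exists (G1 ++ G2) => m m' mm'; apply: opC.
  by apply: H1 => d dG; apply: mm'; rewrite mem_cat dG.
by apply: H2 => d dG; apply: mm'; rewrite mem_cat dG orbT.
Qed.

Fact latfun_join_pred f g : (fun m => Num.max (f m) (g m) : R^o) \in latfun_pred.
Proof.
apply: latfun_op_pred => [x y|x y x' y' e].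
  by rewrite /Num.max; case: ifP => _; rewrite ?lerDl ?lerDr.
rewrite !ler_norml => /andP[a b] /andP[c d].
by rewrite /Num.max; case: ltP => ?; case: ltP => ?; apply/andP; split; lra.
Qed.

Fact latfun_meet_pred f g : (fun m => Num.min (f m) (g m) : R^o) \in latfun_pred.
Proof.
apply: latfun_op_pred => [x y|x y x' y' e].
  by rewrite /Num.min; case: ifP => _; rewrite ?lerDl ?lerDr.
rewrite !ler_norml => /andP[a b] /andP[c d].
by rewrite /Num.min; case: ltP => ?; case: ltP => ?; apply/andP; split; lra.
Qed.

Definition latfun_join f g : latfun := LatFun (latfun_join_pred f g).
Definition latfun_meet f g : latfun := LatFun (latfun_meet_pred f g).
Definition latfun_le f g : bool := `[< forall m, f m <= g m :> R >].

Fact latfun_le_refl : reflexive latfun_le.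
Proof. by move=> f; apply/asboolP. Qed.

Fact latfun_le_anti : antisymmetric latfun_le.
Proof.
move=> f g /andP[/asboolP fg /asboolP gf]; apply: latfun_ext => m.
by apply/eqP; rewrite eq_le; apply/andP; split; [exact: fg|exact: gf].
Qed.

Fact latfun_le_trans : transitive latfun_le.
Proof.
by move=> g f h /asboolP fg /asboolP gh; apply/asboolP => m; exact: le_trans (gh m).
Qed.

Fact latfun_le_meet f g h :
  latfun_le f (latfun_meet g h) = latfun_le f g && latfun_le f h.
Proof.
apply/asboolP/andP => [fgh|[/asboolP fg /asboolP fh] m].
  by split; apply/asboolP => m; have := fgh m; rewrite le_min => /andP[].
by rewrite le_min fg fh.
Qed.

Fact latfun_join_le f g h :
  latfun_le (latfun_join f g) h = latfun_le f h && latfun_le g h.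
Proof.
apply/asboolP/andP => [fgh|[/asboolP fg /asboolP fh] m].
  by split; apply/asboolP => m; have := fgh m; rewrite ge_max => /andP[].
by rewrite ge_max fg fh.
Qed.

Fact latfun_leD2r h f g : latfun_le f g -> latfun_le (f + h) (g + h).
Proof. by move=> /asboolP fg; apply/asboolP => m; rewrite !latfunD lerD2r. Qed.

Fact latfun_leZ (a : R) f g :
  0 <= a -> latfun_le f g -> latfun_le (a *: f) (a *: g).
Proof. by move=> a0 /asboolP fg; apply/asboolP => m; rewrite !latfunZ ler_wpM2l. Qed.

HB.instance Definition _ := Lmodule_isVectorLattice.Build R latfun
  latfun_le_refl latfun_le_anti latfun_le_trans latfun_le_meet latfun_join_le
  latfun_leD2r latfun_leZ.

Lemma latfun_modulus f m : modulus f m = `|f m|.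
Proof. by rewrite /modulus -maxrN. Qed.

Lemma admissible0 : admissible [::].
Proof. by move=> d; rewrite big_nil. Qed.

Lemma admissible1 m : admissible [:: m].
Proof. by move=> d; rewrite big_seq1; exact: (svalP m). Qed.

Definition latfun_norm f : R := sup [set abs_sum f s | s in admissible].

Lemma latfun_has_sup f : has_sup [set abs_sum f s | s in admissible].
Proof.
split; first by exists (abs_sum f [::]), [::] => //; exact: admissible0.
have /latfun_predP[[B fB] _] := valP f.
by exists B => _ [s sa <-]; exact: fB.
Qed.

Lemma abs_sum_le f s : admissible s -> abs_sum f s <= latfun_norm f.
Proof. by move=> sa; apply: ub_le_sup; [case: (latfun_has_sup f)|exists s]. Qed.

Lemma latfun_norm_le f B :
  (forall s, admissible s -> abs_sum f s <= B) -> latfun_norm f <= B.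
Proof.
move=> fB; apply: ge_sup; first by case: (latfun_has_sup f).
by move=> _ [s sa <-]; exact: fB.
Qed.

(** One dominated function is an admissible family, so the norm dominates the supremum norm and
    point evaluations are continuous. *)
Lemma latfun_val_le f m : `|f m| <= latfun_norm f.
Proof.
by have := abs_sum_le f (@admissible1 m); rewrite /abs_sum big_seq1.
Qed.

Fact latfun_normD f g : latfun_norm (f + g) <= latfun_norm f + latfun_norm g.
Proof.
apply: latfun_norm_le => s sa.
rewrite (le_trans _ (lerD (abs_sum_le f sa) (abs_sum_le g sa))) //.
by rewrite -big_split ler_sum // => m _; exact: ler_normD.
Qed.

Lemma abs_sumZ a f s : abs_sum (a *: f) s = `|a| * abs_sum f s.
Proof. by rewrite mulr_sumr; apply: eq_bigr => m _; rewrite -normrM. Qed.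

Fact latfun_normZ a f : latfun_norm (a *: f) = `|a| * latfun_norm f.
Proof.
have le b h : latfun_norm (b *: h) <= `|b| * latfun_norm h.
  by apply: latfun_norm_le => s sa; rewrite abs_sumZ ler_wpM2l // abs_sum_le.
apply/eqP; rewrite eq_le le /=.
have [->|a0] := eqVneq a 0.
  rewrite normr0 mul0r; have := abs_sum_le (0 *: f) admissible0.
  by rewrite /abs_sum big_nil.
by rewrite -ler_pdivlMl ?normr_gt0 // -normfV -{1}[f](scalerK a0) le.
Qed.

Fact latfun_norm0_eq0 f : latfun_norm f = 0 -> f = 0.
Proof.
move=> f0; apply: latfun_ext => m; apply/eqP.
by rewrite -normr_le0 -f0 latfun_val_le.
Qed.

HB.instance Definition _ :=
  Lmodule_isNormed.Build R latfun latfun_normD latfun_normZ latfun_norm0_eq0.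

Lemma latfun_normE f : `|f| = latfun_norm f. Proof. by []. Qed.

Fact latfun_complete (F : set_system latfun) :
  ProperFilter F -> cauchy F -> cvg F.
Proof.
move=> FF /cauchyP FC.
have FR m : cvg ((fun f => f m : R^o) @ F).
  apply: cauchy_cvg; apply/cauchyP => e e0.
  have [g Fg] := FC e e0; exists (g m).
  suff : F [set f | ball (g m : R^o) e (f m)] by [].
  apply: filterS Fg => f; rewrite -!ball_normE /= => gf; apply: le_lt_trans gf.
  exact: (latfun_val_le (g - f) m).
pose l : domfun -> R^o := fun m => lim ((fun f => f m : R^o) @ F).
(* The bound on each finite sum passes to the pointwise limit, with one [g] for all admissible
   [s]. *)
have lP e : 0 < e -> exists2 g, F (ball g e) &
    forall s, admissible s -> abs_sum (fun m => g m - l m) s <= e.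
  move=> e0; have [g Fg] := FC e e0; exists g => // s sa.
  have tc : (fun f => abs_sum (fun m => g m - f m) s) @ F -->
      abs_sum (fun m => g m - l m) s.
    apply: cvg_big => [|m _]; first exact: add_continuous.
    apply: cvg_norm; apply: cvgB; first exact: cvg_cst.
    exact: FR.
  rewrite -(cvg_lim _ tc) //; apply: limr_le; first by apply/cvg_ex; eexists; exact: tc.
  apply: filterS Fg => f; rewrite -ball_normE /= => /ltW; apply: le_trans.
  exact: (abs_sum_le (g - f)).
have lX : l \in latfun_pred.
  apply/latfun_predP; split.
    have [g _ gl] := lP 1 ltr01; exists (`|g| + 1) => s sa.
    rewrite (le_trans _ (lerD (abs_sum_le g sa) (gl s sa))) //.
    rewrite -big_split ler_sum // => m _.
    rewrite -[X in `|X| <= _](subKr (g m)) (le_trans (ler_normB _ _)) //.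
  (* On one-member families [lP] is uniform approximation within [e / 3], and [finitary] survives
     uniform limits. *)
  move=> e e0; have e3 : 0 < e / 3 by rewrite divr_gt0.
  have [g _ gl] := lP _ e3.
  have /latfun_predP[_ /(_ _ e3) [G GP]] := valP g.
  exists G => m m' /GP; have := gl _ (@admissible1 m); have := gl _ (@admissible1 m').
  rewrite /abs_sum !big_seq1.
  have near3 (a b c d : R) :
      `|b - d| <= e / 3 -> `|a - c| <= e / 3 -> `|a - b| <= e / 3 -> `|c - d| <= e.
    rewrite !ler_norml => /andP[? ?] /andP[? ?] /andP[? ?].
    by apply/andP; split; lra.
  exact: near3.
apply/cvg_ex; exists (LatFun lX); apply/cvg_ballP => e e0.
have e2 : 0 < e / 2 by rewrite divr_gt0.
have [g Fg gl] := lP _ e2.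
apply: filterS Fg => f; rewrite -!ball_normE /= => gf.
rewrite -(subrK g (LatFun lX)) -addrA (le_lt_trans (ler_normD _ _)) //.
rewrite [e]splitr ler_ltD // -normrN opprB.
exact: latfun_norm_le.
Qed.

HB.instance Definition _ := Uniform_isComplete.Build latfun latfun_complete.

Fact latfun_norm_mono f g : vle (modulus f) (modulus g) -> `|f| <= `|g|.
Proof.
move=> /asboolP fg; apply: latfun_norm_le => s sa.
apply: le_trans (abs_sum_le g sa); apply: ler_sum => m _.
by rewrite -!latfun_modulus.
Qed.

HB.instance Definition _ :=
  VectorLattice_isBanachLattice.Build R latfun latfun_norm_mono.

Definition vanishing (Z : set domfun) : {pred latfun} :=
  fun f => `[< forall m, Z m -> f m = 0 >].

Fact vanishing_submod Z : submod_closed (vanishing Z).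
Proof.
split; first by apply/asboolP.
move=> a f g /asboolP f0 /asboolP g0; apply/asboolP => m Zm.
by rewrite latfunD latfunZ f0 // g0 // mulr0 addr0.
Qed.

Fact vanishing_solid Z f g :
  vle (modulus f) (modulus g) -> g \in vanishing Z -> f \in vanishing Z.
Proof.
move=> /asboolP fg /asboolP g0; apply/asboolP => m Zm; apply/eqP.
by have := fg m; rewrite !latfun_modulus g0 // normr0 normr_le0.
Qed.

Fact vanishing_closed Z : closed [set` vanishing Z].
Proof.
move=> f clf; apply/asboolP => m Zm; apply/eqP; rewrite -normr_le0.
apply/ler_addgt0Pr => e e0; rewrite add0r.
have [g [/asboolP g0]] := clf _ (nbhsx_ballx f e e0).
rewrite -ball_normE /= => /ltW; apply: le_trans.
by have := latfun_val_le (f - g) m; rewrite latfunB g0 // subr0.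
Qed.

Definition vanishing_ideal Z : closedIdeal latfun :=
  ClosedIdeal (vanishing_submod Z) (@vanishing_solid Z) (@vanishing_closed Z).

(** Admissibility at [x] is the required bound on sums, and [x] is the only coordinate involved. *)
Fact evaluation_pred (x : E) : (fun m : domfun => sval m x : R^o) \in latfun_pred.
Proof.
apply/latfun_predP; split; first by exists `|x| => s; exact.
move=> e e0; exists [:: x] => m m' mm'.
by rewrite mm' ?mem_seq1 // subrr normr0 ltW.
Qed.

Definition evaluation (x : E) : latfun := LatFun (evaluation_pred x).

Lemma evaluation_norm x : `|evaluation x| <= `|x|.
Proof. by apply: latfun_norm_le => s; exact. Qed.

End FunctionLattice.

(** * The gliding hump that excludes a bounded lift *)

Section Obstruction.
Variables (R : realType) (E : normedModType R).
Local Notation X := (latfun E).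

(** Cutting [g] off outside [G] may destroy linearity but keeps domination, which is all that
    [domfun] requires. *)
Lemma truncation_subproof (g : {linear E -> R^o}) (G : seq E) :
  (forall x, `|g x| <= `|x| / 2) ->
  forall d, `|if d \in G then g d else 0| <= `|d|.
Proof.
move=> g2 d; case: ifP => _; last by rewrite normr0.
by rewrite (le_trans (g2 d)) // ler_piMr // invf_le1 ?ler1n.
Qed.

Lemma functional_point (g : {linear E -> R^o}) :
  (forall x, `|g x| <= `|x| / 2) -> exists m : domfun E, sval m = g.
Proof.
move=> g2; have gm d : `|g d| <= `|d|.
  by rewrite (le_trans (g2 d)) // ler_piMr // invf_le1 ?ler1n.
by exists (exist _ (g : E -> R) gm).
Qed.

(** At a fixed [d] the terms vanish before the first [k] with [d] in [G k]; that term is at most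
    [|d| / 2], and the later ones decay geometrically. *)
Lemma truncations_admissible (q : nat -> domfun E) (G : nat -> seq E) :
  (forall k d, `|sval (q k) d| <= `|d| / 2) ->
  (forall k d, d \notin G k -> sval (q k) d = 0) ->
  (forall l k d, (l < k)%N -> d \in G l ->
     `|sval (q k) d| <= 2^-1 ^+ k.+2 * `|d|) ->
  forall K, admissible (mkseq q K).
Proof.
move=> q2 q0 qs K d; rewrite big_map -/(iota 0 K).
pose S N := \sum_(i <- iota 0 N) `|sval (q i) d|.
have SS N : S N.+1 = S N + `|sval (q N) d|.
  by rewrite /S -addn1 iotaD big_cat big_seq1.
have pos N : 0 < 2^-1 ^+ N :> R by rewrite exprn_gt0 ?invr_gt0.
have S0 N : (forall k, (k < N)%N -> d \notin G k) -> S N = 0.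
  elim: N => [|N IH] dG; first by rewrite /S big_nil.
  by rewrite SS q0 ?dG // normr0 addr0 IH // => k kN; rewrite dG // ltnW.
(* The margin below [|d|] halves at each step, which leaves room for the next small term. *)
suff : S K <= `|d| * (1 - 2^-1 ^+ K).
  by move/le_trans; apply; rewrite ler_piMr // gerBl ltW.
elim: K => [|K IH]; first by rewrite /S big_nil expr0 subrr mulr0.
rewrite SS; have [[l lK dl]|no] := pselect (exists2 l, (l < K)%N & d \in G l).
  have := qs l K d lK dl; move: IH (pos K); rewrite !exprS.
  move: (S K) (`|sval _ _|) (2^-1 ^+ K) (`|d|) (normr_ge0 d) => a b t D D0 h1 t0 h2.
  by have := mulr_ge0 D0 (ltW t0); nra.
rewrite S0 ?add0r => [|k kK]; last by apply/negP => dk; apply: no; exists k.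
rewrite (le_trans (q2 K d)) // ler_wpM2l // exprS.
have : 2^-1 ^+ K <= 1 :> R by rewrite exprn_ile1 ?invr_ge0 // invf_le1 ?ler1n.
by lra.
Qed.

(* [L] lifts, modulo the functions vanishing on the linear functionals, the
   evaluation map of [E]. *)
Lemma no_bounded_lift (L : {linear E -> X}) (z : nat -> E) (c : R) :
  bounded_operator L ->
  (forall x (m : domfun E) (g : {linear E -> R^o}), sval m = g -> L x m = g x) ->
  weakly_converges z 0 -> 0 < c -> ~ (forall n, c <= `|z n|).
Proof.
move=> [C LC] Lg z0 c0 cz.
have c16 : 0 < c / 16 by rewrite divr_gt0.
have /choice[G GP] n : exists G : seq E, forall m m' : domfun E,
    {in G, sval m =1 sval m'} -> `|L (z n) m - L (z n) m'| <= c / 16.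
  by have /latfun_predP[_ /(_ _ c16)] := valP (L (z n)).
(* [s] holds the pairs chosen so far. The new functional is large at its own vector and tiny on the
   earlier sets; [size s <= t.1] sends the indices to infinity. *)
pose P (s : seq (nat * {linear E -> R^o})) (t : nat * {linear E -> R^o}) :=
  [/\ (size s <= t.1)%N, forall x, `|t.2 x| <= `|x| / 2, c / 8 <= t.2 (z t.1) &
      forall d, d \in flatten [seq G p.1 | p <- s] ->
        `|t.2 d| <= 2^-1 ^+ (size s).+2 * `|d|].
have [s|a aP] := @choose_history _ P.
  have e0 : 0 < 2^-1 ^+ (size s).+2 :> R by rewrite exprn_gt0 ?invr_gt0.
  have [n [g ng]] := almost_annihilating_functional
    (flatten [seq G p.1 | p <- s]) (size s) z0 c0 cz e0.
  by exists (n, g).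
pose n k := (a k).1; pose g k := (a k).2.
have nk k : (k <= n k)%N by have [+ _ _ _] := aP k; rewrite size_mkseq.
have g2 k x : `|g k x| <= `|x| / 2 by have [_ + _ _] := aP k.
have gz k : c / 8 <= g k (z (n k)) by have [_ _ + _] := aP k.
have gs l k d : (l < k)%N -> d \in G (n l) -> `|g k d| <= 2^-1 ^+ k.+2 * `|d|.
  move=> lk dl; have [_ _ _] := aP k; rewrite size_mkseq; apply.
  apply/flattenP; exists (G (n l)) => //; apply/mapP; exists (a l) => //.
  by apply/mapP; exists l => //; rewrite mem_iota.
pose q k : domfun E := exist _ _ (@truncation_subproof (g k) (G (n k)) (g2 k)).
have qadm : forall K, admissible (mkseq q K).
  apply: (@truncations_admissible _ (G \o n)) => [k d|k d|l k d lk dl] /=.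
  - case: ifP => _; first exact: g2.
    by rewrite normr0 divr_ge0.
  - by move/negbTE->.
  - case: ifP => _; first exact: gs dl.
    by rewrite normr0 mulr_ge0 // exprn_ge0 // invr_ge0.
(* Even where [q k] is not linear, the value of [L x] at [q k] is linear in [x]. *)
have /choice[h hE] k : exists h : {linear E -> R^o}, forall x, h x = L x (q k).
  have [|h hE] := @linear_of R E R^o (fun x => L x (q k)); last by exists h.
  by move=> b x y; rewrite linearP.
have hC x N : \sum_(0 <= k < N) `|h k x| <= C * `|x|.
  apply: le_trans (LC x); rewrite latfun_normE.
  apply: le_trans (abs_sum_le (L x) (qadm N)).
  rewrite /abs_sum big_map /index_iota subn0.
  by rewrite le_eqVlt; apply/orP; left; apply/eqP/eq_bigr => k _; rewrite hE.
apply: (schur_l1 hC (weakly_converges_subseq nk z0) c16) => k /=.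
have [m mg] := functional_point (g2 k).
(* On [G (n k)] the truncation agrees with the full functional, at which [L] is known; passing to
   [q k] costs [c / 16] out of [c / 8]. *)
have mq : {in G (n k), sval m =1 sval (q k)} by move=> d dG; rewrite /= dG mg.
have := GP (n k) m (q k) mq; rewrite (Lg _ _ _ mg) -hE => hq.
have := gz k; have := le_trans (ler_norm _) hq.
have fin (A B : R) : A - B <= c / 16 -> c / 8 <= A -> c / 16 <= B.
  by move=> ? ?; lra.
exact: fin.
Qed.

End Obstruction.

(** * Lifting the evaluation map through the free Banach lattice *)

Theorem theorem1p3 (R : realType) (E : completeNormedModType R)
    (F : banachLatticeType R) (u : {linear E -> F}) :
  is_FBL u -> infty_projective F -> schur_property E.
Proof.
move=> [[Cu uC] univ] [lambda _ proj] x [l xl].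
pose J := vanishing_ideal [set m : domfun E | exists g : {linear E -> R^o}, sval m = g].
have [|T0 T0E] := @linear_of R E (ideal_quotient J)
    (fun y => quotient_map J (evaluation y)).
  (* Equality modulo [J] is tested only at linear [m], where evaluation is linear in the vector. *)
  move=> a y y'; rewrite -linearZ -quotient_mapD.
  apply/quotient_map_eq/asboolP => m [g mg].
  by rewrite latfunB latfunD latfunZ /= mg linearP subrr.
have T0b : bounded_operator T0.
  exists 1 => y; rewrite mul1r T0E.
  exact: le_trans (qnorm_le _ _) (evaluation_norm y).
have [S [Shom SE _ _]] := univ _ T0 T0b.
have [T [[[CT TC] _ _] TE _]] := proj _ J S Shom.
pose L : {linear E -> latfun E} := T \o u.
have Lb : bounded_operator L.
  (* [CT] may be negative, so its absolute value multiplies the bound for [u]. *)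
  exists (`|CT| * Cu) => y; rewrite (le_trans (TC _)) // -mulrA.
  rewrite (le_trans (ler_wpM2r (normr_ge0 _) (ler_norm CT))) //.
  by rewrite ler_wpM2l.
have Lg y (m : domfun E) (g : {linear E -> R^o}) : sval m = g -> L y m = g y.
  move=> mg; have /quotient_map_eq/asboolP/(_ m) :
      quotient_map J (L y) = quotient_map J (evaluation y).
    by rewrite -TE SE T0E.
  by rewrite latfunB /= mg => /(_ (ex_intro _ g erefl)) /subr0_eq.
apply/cvg_ex; exists l; apply/cvgrPdist_lt => e e0.
apply: contrapT => far.
(* Without norm convergence there are terms arbitrarily far out at distance at least [e] from [l];
   their differences with [l] are weakly null. *)
have /choice[n nP] k : exists n, (k <= n)%N /\ e <= `|x n - l|.
  apply: contrapT => close; apply: far; exists k => // n /= kn.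
  rewrite ltNge; apply/negP => en; apply: close; exists n; split => //.
  by rewrite distrC.
have z0 : weakly_converges (fun k => x (n k) - l) 0.
  have nk k : (k <= n k)%N by have [] := nP k.
  move=> f fb; have := weakly_converges_subseq nk xl fb => fxl.
  rewrite linear0 -(subrr (f l)).
  have -> : (fun k => f (x (n k) - l)) = (fun k => f ((x \o n) k) - f l).
    by apply/funext => k; rewrite linearB.
  by apply: cvgB => //; exact: cvg_cst.
by apply: (no_bounded_lift Lb Lg z0 e0) => k; have [] := nP k.
Qed.
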